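(* Let $r\geq3$ and $n\ge1$. If $r$ is odd, then $$\det(1;T_1^{(r)},T_3^{(r)},\ldots,T_{2n-1}^{(r)})=(-1)^{n-1}a_n,$$ where $a_n=0$ for $1\le n<\frac{r+1}{2}$, $a_n=F_{2n-r+1}$ for $\frac{r+1}{2}\le n<r$, $a_r=1+F_{r+1}$, and $a_n=3a_{n-1}-a_{n-2}+a_{n-\frac{r+1}{2}}$ for $n\geq r+1$. If $r$ is even, then $$\det(1;T_1^{(r)},T_3^{(r)},\ldots,T_{2n-1}^{(r)})=(-1)^{n-1}b_n,$$ where $b_n=0$ for $1\le n<\frac r2$, $b_n=F_{2n-r+1}$ for $\frac r2\le n\le r$, and $b_n=3b_{n-1}-b_{n-2}+b_{n-\frac r2}-b_{n-\frac r2-1}$ for $n\geq r+1$.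
   Context: For $r\ge3$, the generalized $r$-tribonacci numbers are defined by $T_0^{(r)}=\cdots=T_{r-2}^{(r)}=0$, $T_{r-1}^{(r)}=1$, and $T_n^{(r)}=T_{n-1}^{(r)}+T_{n-2}^{(r)}+T_{n-r}^{(r)}$ for $n\geq r$. $F_n$ are the Fibonacci numbers ($F_0=0$, $F_1=1$, $F_n=F_{n-1}+F_{n-2}$). For numbers $a_0,\ldots,a_n$, $\det(a_0;a_1,\ldots,a_n)$ denotes the determinant of the $n\times n$ Toeplitz--Hessenberg matrix whose $(i,j)$ entry is $a_{i-j+1}$ if $i-j+1\ge0$ and $0$ otherwise; here the $k$-th entry after the semicolon is $T_{2k-1}^{(r)}$. *)

(* Defs.v *)
From mathcomp Require Import all_boot all_order all_algebra.
From mathcomp Require Import zify.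

Set Implicit Arguments.
Unset Strict Implicit.
Unset Printing Implicit Defensive.

Import GRing.Theory.
Local Open Scope ring_scope.

(* Course-of-values recursion: [cov_seq G] is the sequence u with
   u n = G u n, as soon as [G u n] only consults u at indices below n (this is
   [cov_seqE]); [cov_rec] uses its [nat] argument as fuel. *)
Fixpoint cov_rec (G : (nat -> int) -> nat -> int) (k n : nat) : int :=
  G (if k is k'.+1 then cov_rec G k' else fun=> 0) n.

Definition cov_seq (G : (nat -> int) -> nat -> int) (n : nat) : int :=
  cov_rec G n n.

Lemma cov_seqE (G : (nat -> int) -> nat -> int) :
    (forall u v n, (forall m, (m < n)%N -> u m = v m) -> G u n = G v n) ->
  forall n, cov_seq G n = G (cov_seq G) n.
Proof.
move=> Gext; have fuel n : forall k, (n <= k)%N -> cov_rec G k n = cov_seq G n.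
  elim/ltn_ind: n => n IHn [|k] le_nk; first by case: n IHn le_nk.
  rewrite /cov_seq; case: n IHn le_nk => [|n] IHn le_nk /=; apply: Gext => // m.
  by rewrite ltnS => le_mn; rewrite !IHn // (leq_trans le_mn).
case=> [|n]; first exact: Gext.
by rewrite {1}/cov_seq /=; apply: Gext => m; rewrite ltnS => /fuel.
Qed.

Fixpoint fib (n : nat) : int :=
  match n with
  | 0 => 0
  | 1 => 1
  | (n''.+1 as n').+1 => fib n' + fib n''
  end.

Definition trib (r : nat) : nat -> int :=
  cov_seq (fun T n =>
    if (n < r - 1)%N then 0
    else if n == (r - 1)%N then 1
    else T (n - 1)%N + T (n - 2)%N + T (n - r)%N).

(* a_n and b_n are indexed from n = 1; the values at n = 0 are never used. The index
   2n - r + 1 is written 2 * n + 1 - r so that truncated subtraction is exact. *)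
Definition a_seq (r : nat) : nat -> int :=
  cov_seq (fun a n =>
    if (n < (r + 1)./2)%N then 0
    else if (n < r)%N then fib (2 * n + 1 - r)
    else if n == r then 1 + fib (r + 1)
    else 3 * a (n - 1)%N - a (n - 2)%N + a (n - (r + 1)./2)%N).

Definition b_seq (r : nat) : nat -> int :=
  cov_seq (fun b n =>
    if (n < r./2)%N then 0
    else if (n <= r)%N then fib (2 * n + 1 - r)
    else 3 * b (n - 1)%N - b (n - 2)%N + b (n - r./2)%N - b (n - r./2 - 1)%N).

Lemma fibSS (n : nat) : fib n.+2 = fib n.+1 + fib n.
Proof. by []. Qed.

Lemma tribE (r n : nat) : (3 <= r)%N ->
  trib r n = if (n < r - 1)%N then 0
             else if n == (r - 1)%N then 1
             else trib r (n - 1) + trib r (n - 2) + trib r (n - r).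
Proof.
move=> r_ge3; apply: (cov_seqE _ n) => u v m uv.
by case: ltnP => // ?; case: eqP => // ?; rewrite !uv //; lia.
Qed.

Lemma a_seqE (r n : nat) : (3 <= r)%N ->
  a_seq r n = if (n < (r + 1)./2)%N then 0
              else if (n < r)%N then fib (2 * n + 1 - r)
              else if n == r then 1 + fib (r + 1)
              else 3 * a_seq r (n - 1) - a_seq r (n - 2)
                   + a_seq r (n - (r + 1)./2).
Proof.
move=> r_ge3; apply: (cov_seqE _ n) => u v m uv.
by do 2![case: ltnP => // ?]; case: eqP => // ?; rewrite !uv //; lia.
Qed.

Lemma b_seqE (r n : nat) : (3 <= r)%N ->
  b_seq r n = if (n < r./2)%N then 0
              else if (n <= r)%N then fib (2 * n + 1 - r)
              else 3 * b_seq r (n - 1) - b_seq r (n - 2)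
                   + b_seq r (n - r./2) - b_seq r (n - r./2 - 1).
Proof.
move=> r_ge3; apply: (cov_seqE _ n) => u v m uv.
by case: ltnP => // ?; case: leqP => // ?; rewrite !uv //; lia.
Qed.

(* The n x n matrix of det(a_0; a_1, ..., a_n). The entry a_{i-j+1} depends
   only on i - j, so 0-based indices give the same matrix as 1-based ones; the
   test j <= i + 1 also makes the truncated subtraction exact. *)
Definition hessenberg_mx (n : nat) (a : nat -> int) : 'M[int]_n :=
  \matrix_(i < n, j < n) if (j <= i + 1)%N then a (i + 1 - j)%N else 0.

(* det(a0; a 1, ..., a n); the value [a 0] is ignored. *)
Definition hessenberg_det (n : nat) (a0 : int) (a : nat -> int) : int :=
  \det (hessenberg_mx n (fun k => if k == 0%N then a0 else a k)).

(* Main.v *)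
(* Put A(x) = sum_(k >= 1) T_(2k-1) x^k. The Hessenberg matrix is the minor of
   the (n+1) x (n+1) lower triangular Toeplitz matrix of 1 + A obtained by
   deleting the first row and the last column, so its determinant is (-1)^n times
   the n-th coefficient of 1 / (1 + A). Bisecting the generating function of the
   T_n gives A as a rational function, and 1 / (1 + A) = 1 - C with
     C = x^(s+1) (1 + x^s) / (1 - 3x + x^2 - x^(s+1))       if r = 2s + 1,
     C = x^m (1 - x - x^m) / (1 - 3x + x^2 - x^m + x^(m+1))  if r = 2m,
   which are the generating functions of a_n and b_n. Power series are replaced
   by polynomials modulo X^N with an explicit quotient, which keeps every step a
   ring identity. *)
Require Import Defs.
From mathcomp Require Import all_boot all_order all_algebra.
From mathcomp Require Import zify ring.
Import GRing.Theory.
Local Open Scope ring_scope.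

(** Cramer's rule: the coefficients of [q] solve the unitriangular system [L *m v = delta_mx 0 0],
    and the last unknown is a corner cofactor of [L] whose minor is the Hessenberg matrix. *)
Lemma det_hessenberg_coef (n : nat) (p q : {poly int}) :
  p`_0 = 1 -> (forall i, (i <= n)%N -> (p * q)`_i = (i == 0%N)%:R) ->
  \det (hessenberg_mx n (fun k => p`_k)) = (-1) ^+ n * q`_n.
Proof.
move=> p0 pq.
pose L : 'M[int]_n.+1 := \matrix_(i, j) if (j <= i)%N then p`_(i - j) else 0.
pose v : 'cV[int]_n.+1 := \col_i q`_i.
have detL : \det L = 1.
  rewrite det_trig; last by apply/is_trig_mxP => i j ij; rewrite mxE leqNgt ij.
  by rewrite big1 // => i _; rewrite mxE leqnn subnn.
have Lv : L *m v = delta_mx 0 0.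
  apply/matrixP => i j; rewrite !mxE ord1 eqxx andbT.
  have -> : (i == 0) = (i == 0%N :> nat) by [].
  rewrite -pq; last by rewrite -ltnS.
  rewrite coefMr (big_ord_widen n.+1 (fun k => p`_(i - k) * q`_k)) //.
  rewrite [RHS]big_mkcond; apply: eq_bigr => k _; rewrite !mxE ltnS.
  by case: leqP => // _; rewrite mul0r.
have : v ord_max 0 = cofactor L 0 ord_max.
  rewrite -[v]mul1mx -{1}detL -mul_adj_mx -mulmxA Lv.
  rewrite mxE (bigD1 ord0) //= big1 => [|k k0]; rewrite !mxE ?mulr1 ?addr0 //.
  by rewrite (negbTE k0) mulr0.
rewrite mxE /cofactor /= add0n => ->.
rewrite mulrA -exprMn mulrNN mulr1 expr1n mul1r.
congr (\det _); apply/matrixP => i j; rewrite !mxE !lift0 lift_max addn1.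
by case: i j => [i ?] [j ?].
Qed.

Lemma small_coef0_dvd (N : nat) (p : {poly int}) :
  (forall i, (i < N)%N -> p`_i = 0) -> exists w, p = w * 'X^N.
Proof.
move=> p0; exists (drop_poly N p); rewrite -[LHS](poly_take_drop N).
suff -> : take_poly N p = 0 by rewrite add0r.
by apply/polyP => i; rewrite coef_take_poly coef0; case: ltnP => // /p0.
Qed.

Lemma dvd_cancel_unit (N : nat) (p u w : {poly int}) :
  (1 - 'X * u) * p = w * 'X^N -> exists w', p = w' * 'X^N.
Proof.
move=> E; pose g := \sum_(i < N) ('X * u) ^+ i.
have G : 1 - ('X * u) ^+ N = g * (1 - 'X * u).
  by rewrite -opprB subrX1 -mulNr opprB mulrC.
(* Comes from [p = g * (1 - 'X * u) * p + ('X * u) ^+ N * p], where [g] is the truncated geometric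
   series. *)
exists (g * w + u ^+ N * p).
have : g * ((1 - 'X * u) * p) = (1 - ('X * u) ^+ N) * p by rewrite G mulrA.
rewrite E exprMn => H; rewrite -[LHS](subrK ('X^N * u ^+ N * p)).
by rewrite -{1}[p]mul1r -mulrBl -H; ring.
Qed.

(** For [i < k] the coefficient vanishes and [i - k] truncates to 0, so [f 0 = 0] merges both cases
    into one formula. *)
Lemma coef_polyMXn (N k i : nat) (f : nat -> int) : f 0%N = 0 -> (i < N)%N ->
  ((\poly_(j < N) f j) * 'X^k)`_i = f (i - k)%N.
Proof.
move=> f0 iN; rewrite coefMXn; case: ltnP => [ik|ki].
  by rewrite (_ : (i - k)%N = 0%N) // ; lia.
by rewrite coef_poly ifT // (leq_ltn_trans (leq_subr _ _)).
Qed.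

Lemma hessenberg_det_gen (n : nat) (f c : nat -> int) :
  f 0%N = 0 -> c 0%N = 0 -> (0 < n)%N ->
  (exists w, (1 + \poly_(i < n.+1) f i) * (1 - \poly_(i < n.+1) c i)
             = 1 + w * 'X^(n.+1)) ->
  hessenberg_det n 1 f = (-1) ^+ (n - 1)%N * c n.
Proof.
move=> f0 c0 n_gt0 [w E].
set p := 1 + _ in E; set q := 1 - _ in E.
have pE k : (k <= n)%N -> p`_k = if k == 0%N then 1 else f k.
  move=> kn; rewrite /p coefD coef1 coef_poly ltnS kn.
  by case: eqP => [->|_]; rewrite ?f0 ?addr0 ?add0r.
have qn : q`_n = - c n.
  by rewrite /q coefB coef1 coef_poly ltnS leqnn eqn0Ngt n_gt0 sub0r.
have -> : hessenberg_det n 1 f = \det (hessenberg_mx n (fun k => p`_k)).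
  congr (\det _); apply/matrixP => i j; rewrite !mxE.
  by case: ifP => // _; rewrite pE //; have := ltn_ord i; lia.
rewrite (@det_hessenberg_coef n p q) ?pE // => [|i i_n].
  have -> : (-1) ^+ n = - (-1) ^+ (n - 1) :> int.
    by rewrite -[in LHS](subnK n_gt0) addn1 exprS mulN1r.
  by rewrite qn mulrNN.
by rewrite E coefD coef1 coefMXn ltnS i_n addr0.
Qed.

(* Truncated subtraction does no harm here: out-of-range indices become 0, and
   trib r 0 = 0. *)
Lemma trib_rec (r n : nat) : (3 <= r)%N ->
  trib r n = (n == r - 1)%N%:R + trib r (n - 1) + trib r (n - 2) + trib r (n - r).
Proof.
move=> r_ge3; have z m : (m < r - 1)%N -> trib r m = 0 by rewrite tribE // => ->.
have [nr|nr] := ltnP n (r - 1).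
  by rewrite !z; try lia; rewrite ltn_eqF.
rewrite {1}tribE // ltnNge nr /=; case: eqP => [->|_]; last by rewrite add0r.
by rewrite !z ?addr0 //; lia.
Qed.

Lemma fib_step2 (n : nat) : fib n.+4 = 3 * fib n.+2 - fib n.
Proof. by rewrite /=; ring. Qed.

(* O, E and C stand for the truncated generating functions of T_(2k-1), T_(2k) and
   a_k (b_k in gf_even); the trivial factors 'X^0 make all terms of the hypotheses
   instances of coef_polyMXn. *)
Lemma gf_odd (N s : nat) (O E C a b c : {poly int}) :
  O * 'X^0 - O * 'X^1 - E * 'X^1 - E * 'X^(s.+1) = a * 'X^N ->
  E * 'X^0 - E * 'X^1 - O * 'X^0 - O * 'X^s - 'X^s = b * 'X^N ->
  C * 'X^0 - C * 'X^1 *+ 3 + C * 'X^2 - C * 'X^(s.+1)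
    - 'X^(s.+1) - 'X^((2 * s).+1) = c * 'X^N ->
  exists w, (1 + O) * (1 - C) = 1 + w * 'X^N.
Proof.
move=> h1 h2 h3.
(* These multipliers eliminate [E] from the first two relations, leaving D O = P + w1 X^N with D =
   (1 - X)^2 - X (1 + X^s)^2 and P = X^(s+1) (1 + X^s). *)
set w1 := a * (1 - 'X) + 'X * (1 + 'X^s) * b.
have [w' H] : exists w, O - C - O * C = w * 'X^N.
  (* The third relation reads Q C = P + c X^N, and D = Q - P. Hence D (O - C - O C) = ((1 - C) w1 -
     c) X^N, where D has the form 1 - X u. *)
  apply: (@dvd_cancel_unit N _ (2%:R - 'X + (1 + 'X^s) ^+ 2) ((1 - C) * w1 - c)).
  have -> : ((1 - C) * w1 - c) * 'X^N =
    (1 - C) * ((a * 'X^N) * (1 - 'X) + 'X * (1 + 'X^s) * (b * 'X^N)) - c * 'X^N.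
    by rewrite /w1; ring.
  by rewrite -h1 -h2 -h3 mul2n -addnn !exprS exprD; ring.
by exists w'; rewrite -H; ring.
Qed.

Lemma gf_even (N m : nat) (O E C a b c : {poly int}) : (0 < m)%N ->
  O * 'X^0 - O * 'X^1 - E * 'X^1 - O * 'X^m - 'X^m = a * 'X^N ->
  E * 'X^0 - E * 'X^1 - O * 'X^0 - E * 'X^m = b * 'X^N ->
  C * 'X^0 - C * 'X^1 *+ 3 + C * 'X^2 - C * 'X^m + C * 'X^(m.+1)
    - 'X^m + 'X^(m.+1) + 'X^(2 * m) = c * 'X^N ->
  exists w, (1 + O) * (1 - C) = 1 + w * 'X^N.
Proof.
case: m => // m _ h1 h2 h3.
(* Same elimination of [E], now with D = (1 - X - X^(m+1))^2 - X; the positive exponent m+1 again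
   gives D the form 1 - X u. *)
set w1 := a * (1 - 'X - 'X^(m.+1)) + 'X * b.
have [w' H] : exists w, O - C - O * C = w * 'X^N.
  apply: (@dvd_cancel_unit N _
    (2%:R * (1 + 'X^m) - 'X * (1 + 'X^m) ^+ 2 + 1) ((1 - C) * w1 - c)).
  have -> : ((1 - C) * w1 - c) * 'X^N =
    (1 - C) * ((a * 'X^N) * (1 - 'X - 'X^(m.+1)) + 'X * (b * 'X^N)) - c * 'X^N.
    by rewrite /w1; ring.
  by rewrite -h1 -h2 -h3 mul2n -addnn exprD !exprS; ring.
by exists w'; rewrite -H; ring.
Qed.

Lemma hessenberg_det_odd (s n : nat) : (0 < s)%N -> (0 < n)%N ->
  let r := (2 * s).+1 in
  hessenberg_det n 1 (fun k : nat => trib r (2 * k - 1)%N)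
    = (-1) ^+ (n - 1)%N * a_seq r n.
Proof.
move=> s_gt0 n_gt0 r; have r3 : (3 <= r)%N by lia.
have r2 : ((r + 1)./2 = s.+1)%N by lia.
have t0 : trib r 0 = 0 by rewrite tribE // ifT //; lia.
have a0 m : (m <= s)%N -> a_seq r m = 0.
  by move=> ms; rewrite a_seqE // r2 ltnS ms.
(* One formula also covers [m <= s], where [m - s] truncates to 0 and [fib 0 = 0]. *)
have aF m : (m < r)%N -> a_seq r m = fib (2 * (m - s)).
  move=> mr; have [/[dup] ms /a0 ->|sm] := leqP m s.
    by rewrite (_ : (m - s)%N = 0%N) //; lia.
  by rewrite a_seqE // r2 ltnNge sm mr /=; congr fib; lia.
apply: hessenberg_det_gen => //; first exact: a0.
set N := n.+1.
set O := \poly_(i < N) _; set C := \poly_(i < N) a_seq r i.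
pose E := \poly_(i < N) trib r (2 * i).
have cO k i : (i < N)%N -> (O * 'X^k)`_i = trib r (2 * (i - k) - 1).
  exact: coef_polyMXn.
have cE k i : (i < N)%N -> (E * 'X^k)`_i = trib r (2 * (i - k)).
  exact: (@coef_polyMXn _ _ _ (fun i => trib r (2 * i))).
have cC k i : (i < N)%N -> (C * 'X^k)`_i = a_seq r (i - k).
  by apply: coef_polyMXn; exact: a0.
(* Since [r] is odd, the shift by [r] in the recurrence changes parity and exchanges [O] and [E]. *)
have [a h1] : exists w, O * 'X^0 - O * 'X^1 - E * 'X^1 - E * 'X^(s.+1) = w * 'X^N.
  apply: small_coef0_dvd => i iN; rewrite !coefB !cO // !cE // subn0.
  rewrite trib_rec // (_ : _ == _ = false) ?mulr0n; last by lia.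
  rewrite (_ : 2 * i - 1 - 1 = 2 * (i - 1))%N; last lia.
  rewrite (_ : 2 * i - 1 - 2 = 2 * (i - 1) - 1)%N; last lia.
  rewrite (_ : 2 * i - 1 - r = 2 * (i - s.+1))%N; last lia.
  by ring.
(* The term ['X^s] is the initial value 1 at the even index r - 1 = 2s. *)
have [b h2] : exists w,
    E * 'X^0 - E * 'X^1 - O * 'X^0 - O * 'X^s - 'X^s = w * 'X^N.
  apply: small_coef0_dvd => i iN; rewrite !coefB !cO // !cE // !subn0 coefXn.
  rewrite [trib r (2 * i)]trib_rec //.
  rewrite (_ : _ == _ = (i == s)); last by lia.
  rewrite (_ : 2 * i - 2 = 2 * (i - 1))%N; last lia.
  rewrite (_ : 2 * i - r = 2 * (i - s) - 1)%N; last lia.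
  by ring.
(* The monomials record where the recurrence fails: the first nonzero value F_2 = 1 at s+1, and the
   extra 1 in [a_seq r r]. Elsewhere up to [r] it is the Fibonacci bisection [fib_step2]. *)
have [c h3] : exists w, C * 'X^0 - C * 'X^1 *+ 3 + C * 'X^2 - C * 'X^(s.+1)
    - 'X^(s.+1) - 'X^((2 * s).+1) = w * 'X^N.
  apply: small_coef0_dvd => i iN; rewrite !(coefB, coefD, coefMn) !cC // !coefXn subn0.
  have [ir|ri] := ltnP r i.
    have -> : a_seq r i
        = 3 * a_seq r (i - 1) - a_seq r (i - 2) + a_seq r (i - s.+1).
      by rewrite a_seqE // r2 3?ifF //; lia.
    have -> : (i == s.+1) = false by lia.
    have -> : (i == (2 * s).+1) = false by lia.
    by rewrite !mulr0n; ring.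
  rewrite [a_seq r (i - s.+1)]a0; last lia.
  have [ies|nis] := leqP i s.
    by rewrite !a0 ?ltn_eqF //; lia.
  have [-> {i iN ri nis}|nis1] := eqVneq i s.+1.
    rewrite [a_seq r (s.+1 - 1)]a0; last lia.
    rewrite [a_seq r (s.+1 - 2)]a0; last lia.
    rewrite aF ?subSnn ?ltn_eqF //; lia.
  rewrite !(aF (i - _)%N); try lia.
  have -> : a_seq r i = (i == r)%:R + fib (2 * (i - s)).
    have [->|ir] := eqVneq i r; last by rewrite aF ?add0r //; lia.
    rewrite a_seqE // r2 ltnn eqxx ifF; last lia.
    by congr (_ + fib _); lia.
  rewrite (_ : 2 * (i - s) = (2 * (i - 2 - s)).+4)%N; last lia.
  rewrite (_ : 2 * (i - 1 - s) = (2 * (i - 2 - s)).+2)%N; last lia.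
  by rewrite fib_step2 /r mulr0n; ring.
exact: gf_odd h1 h2 h3.
Qed.

Lemma hessenberg_det_even (m n : nat) : (1 < m)%N -> (0 < n)%N ->
  let r := (2 * m)%N in
  hessenberg_det n 1 (fun k : nat => trib r (2 * k - 1)%N)
    = (-1) ^+ (n - 1)%N * b_seq r n.
Proof.
move=> m_gt1 n_gt0 r; have r3 : (3 <= r)%N by lia.
have r2 : (r./2 = m)%N by lia.
have t0 : trib r 0 = 0 by rewrite tribE // ifT //; lia.
have b0 i : (i < m)%N -> b_seq r i = 0 by move=> im; rewrite b_seqE // r2 im.
have bF i : (m <= i <= r)%N -> b_seq r i = fib (2 * (i - m)).+1.
  move=> /andP[mi ir]; rewrite b_seqE // r2 ir ifF; last lia.
  by congr (fib _); lia.
have b00 : b_seq r 0 = 0 by apply: b0; lia.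
apply: hessenberg_det_gen => //.
set N := n.+1.
set O := \poly_(i < N) _; set C := \poly_(i < N) b_seq r i.
pose E := \poly_(i < N) trib r (2 * i).
have cO k i : (i < N)%N -> (O * 'X^k)`_i = trib r (2 * (i - k) - 1).
  exact: coef_polyMXn.
have cE k i : (i < N)%N -> (E * 'X^k)`_i = trib r (2 * (i - k)).
  exact: (@coef_polyMXn _ _ _ (fun i => trib r (2 * i))).
have cC k i : (i < N)%N -> (C * 'X^k)`_i = b_seq r (i - k).
  exact: coef_polyMXn.
(* Even [r] preserves parity under the shift, and the initial value now sits at the odd index r - 1
   = 2m - 1. *)
have [a h1] : exists w,
    O * 'X^0 - O * 'X^1 - E * 'X^1 - O * 'X^m - 'X^m = w * 'X^N.
  apply: small_coef0_dvd => i iN; rewrite !coefB !cO // !cE // subn0 coefXn.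
  rewrite [trib r (2 * i - 1)]trib_rec // (_ : _ == _ = (i == m)); last by lia.
  rewrite (_ : 2 * i - 1 - 1 = 2 * (i - 1))%N; last lia.
  rewrite (_ : 2 * i - 1 - 2 = 2 * (i - 1) - 1)%N; last lia.
  rewrite (_ : 2 * i - 1 - r = 2 * (i - m) - 1)%N; last lia.
  by ring.
have [b h2] : exists w,
    E * 'X^0 - E * 'X^1 - O * 'X^0 - E * 'X^m = w * 'X^N.
  apply: small_coef0_dvd => i iN; rewrite !coefB !cO // !cE // !subn0.
  rewrite [trib r (2 * i)]trib_rec //.
  rewrite (_ : _ == _ = false) ?mulr0n; last by lia.
  rewrite (_ : 2 * i - 2 = 2 * (i - 1))%N; last lia.
  rewrite (_ : 2 * i - r = 2 * (i - m))%N; last lia.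
  by ring.
have [c h3] : exists w, C * 'X^0 - C * 'X^1 *+ 3 + C * 'X^2 - C * 'X^m
    + C * 'X^(m.+1) - 'X^m + 'X^(m.+1) + 'X^(2 * m) = w * 'X^N.
  apply: small_coef0_dvd => i iN; rewrite !(coefB, coefD, coefMn) !cC // !coefXn subn0.
  have [ir|ri] := ltnP r i.
    have -> : b_seq r i = 3 * b_seq r (i - 1) - b_seq r (i - 2)
        + b_seq r (i - m) - b_seq r (i - m - 1).
      by rewrite b_seqE // r2 2?ifF //; lia.
    have -> : (i == m) = false by lia.
    have -> : (i == m.+1) = false by lia.
    have -> : (i == 2 * m)%N = false by lia.
    by rewrite -subnDA addn1 !mulr0n; ring.
  have [im|mi] := ltnP i m.
    by rewrite !b0 ?ltn_eqF //; lia.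
  rewrite [b_seq r (i - m.+1)]b0; last lia.
  (* Source of the correction ['X^(2 * m)]: at i = r = 2m the values are still plain Fibonacci
     numbers, yet the recurrence would add b_m = F_1 = 1. *)
  have -> : b_seq r (i - m) = (i == 2 * m)%N%:R.
    case: eqP => im; last by rewrite b0 //; lia.
    by rewrite bF im; [rewrite (_ : (2 * (2 * m - m - m)).+1 = 1)%N //; lia|lia].
  have [-> {i iN ri mi}|nim] := eqVneq i m.
    rewrite !(b0 (m - _)%N); try lia.
    rewrite bF ?subnn ?ltn_eqF //; lia.
  have [-> {i iN ri mi nim}|nim1] := eqVneq i m.+1.
    rewrite (b0 (m.+1 - 2)%N); last lia.
    rewrite !bF ?subSnn ?subn1 ?subnn ?ltn_eqF //; lia.
  rewrite !bF; try lia.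
  rewrite (_ : (2 * (i - m)).+1 = (2 * (i - 2 - m)).+1.+4)%N; last lia.
  rewrite (_ : (2 * (i - 1 - m)).+1 = (2 * (i - 2 - m)).+1.+2)%N; last lia.
  by rewrite fib_step2; ring.
by apply: gf_even h1 h2 h3; lia.
Qed.

Theorem theorem7 (r n : nat) (hr : (3 <= r)%N) (hn : (1 <= n)%N) :
  (odd r ->
     hessenberg_det n 1 (fun k : nat => trib r (2 * k - 1)%N)
       = (-1) ^+ (n - 1)%N * a_seq r n) /\
  (~~ odd r ->
     hessenberg_det n 1 (fun k : nat => trib r (2 * k - 1)%N)
       = (-1) ^+ (n - 1)%N * b_seq r n).
Proof.
split=> odd_r.
  have -> : r = (2 * r./2).+1 by lia.
  by apply: hessenberg_det_odd; lia.
have -> : r = (2 * r./2)%N by lia.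
by apply: hessenberg_det_even; lia.
Qed.
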